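(* For any starting point $w^0\in\mathcal{W}$, the sequence $\{w^k\}$ generated by the L-GADMM iteration converges to some $w^\infty\in\mathcal{W}^*$; in particular, $(x_1^\infty,\dots,x_m^\infty)$ is an optimal solution of problem (P).
   Context: Standing setting. Let $m\ge 2$, $\ell$, $n_1,\dots,n_m$ be positive integers. For $i=1,\dots,m$ let $\theta_i:\mathbb{R}^{n_i}\to\mathbb{R}$ be convex, $\mathcal{X}_i\subseteq\mathbb{R}^{n_i}$ nonempty closed convex, $A_i\in\mathbb{R}^{\ell\times n_i}$ of full column rank, and $b\in\mathbb{R}^\ell$. Problem (P): $\min\{\sum_{i=1}^m\theta_i(x_i):\sum_{i=1}^mA_ix_i=b,\ x_i\in\mathcal{X}_i\}$, assumed to have a nonempty solution set. Write $u=(x_1,\dots,x_m)$, $w=(x_1,\dots,x_m,y)$ with $y\in\mathbb{R}^\ell$, $\theta(u)=\sum_i\theta_i(x_i)$, $F(w)=(-A_1^\top y,\dots,-A_m^\top y,\ \sum_iA_ix_i-b)$, $\mathcal{W}=\mathcal{X}_1\times\cdots\times\mathcal{X}_m\times\mathbb{R}^\ell$, and $\mathcal{W}^*=\{w^*\in\mathcal{W}:\theta(u)-\theta(u^* )+(w-w^* )^\top F(w^* )\ge0\ \forall w\in\mathcal{W}\}$ (nonempty). For symmetric $G$, $\|v\|_G^2:=v^\top Gv$; $\|\cdot\|$ is the Euclidean norm. Vectors are partitioned as $w=(R,x_m,y)$ with $R=(x_1,\dots,x_{m-1})$. Parameters: $\rho>0$, $\gamma\in(0,2)$, symmetric positive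 definite $P_i\in\mathbb{R}^{n_i\times n_i}$ ($i=1,\dots,m$) such that $G_1\succ0$, where $G_1$ is the symmetric block matrix with diagonal blocks $P_1,\dots,P_{m-1}$ and $(i,j)$ block $-\rho A_i^\top A_j$ for $i\ne j$, $1\le i,j\le m-1$. Matrices (w.r.t. the partition $(R,x_m,y)$): $Q=\begin{pmatrix}G_1&0&0\\0&\rho A_m^\top A_m+P_m&(1-\gamma)A_m^\top\\0&-A_m&\frac1\rho I_\ell\end{pmatrix}$, $M=\begin{pmatrix}I&0&0\\0&I_{n_m}&0\\0&-\rho A_m&\gamma I_\ell\end{pmatrix}$, $H=\begin{pmatrix}G_1&0&0\\0&P_m+\frac\rho\gamma A_m^\top A_m&\frac{1-\gamma}\gamma A_m^\top\\0&\frac{1-\gamma}\gamma A_m&\frac1{\gamma\rho}I_\ell\end{pmatrix}$, $N=Q^\top+Q-M^\top HM$. L-GADMM iteration: from an arbitrary $w^0=(x_1^0,\dots,x_m^0,y^0)\in\mathcal{W}$, for $k=0,1,2,\dots$: $x_j^{k+1}=\arg\min_{x_j\in\mathcal{X}_j}\{\theta_j(x_j)+\frac\rho2\|A_jx_j+\sum_{i=1,i\ne j}^mA_ix_i^k-b-\frac{y^k}\rho\|^2+\frac12\|x_j-x_j^k\|_{P_j}^2\}$ for $j=1,\dots,m-1$; $x_m^{k+1}=\arg\min_{x_m\in\mathcal{X}_m}\{\theta_m(x_m)+\frac\rho2\|\gamma\sum_{i=1}^{m-1}A_ix_i^{k+1}+(1-\gamma)(b-A_mx_m^k)+A_mx_m-b-\frac{y^k}\rho\|^2+\frac12\|x_m-x_m^k\|_{P_m}^2\}$;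 $y^{k+1}=y^k-\rho\big(\gamma\sum_{i=1}^{m-1}A_ix_i^{k+1}+(1-\gamma)(b-A_mx_m^k)+A_mx_m^{k+1}-b\big)$. Auxiliary sequence: $\bar w^k=(\bar x_1^k,\dots,\bar x_m^k,\bar y^k)$ with $\bar x_i^k=x_i^{k+1}$ ($i=1,\dots,m$) and $\bar y^k=y^k-\rho(\sum_{i=1}^{m-1}A_ix_i^{k+1}+A_mx_m^k-b)$; $\bar u^k=(\bar x_1^k,\dots,\bar x_m^k)$, $R^k=(x_1^k,\dots,x_{m-1}^k)$, $\bar R^k=(\bar x_1^k,\dots,\bar x_{m-1}^k)$. *)

(* Defs.v *)
From HB Require Import structures.
From mathcomp Require Import all_boot all_order all_algebra.
From mathcomp Require Import all_classical all_reals all_analysis.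
Set Implicit Arguments. Unset Strict Implicit. Unset Printing Implicit Defensive.
Import Order.TTheory GRing.Theory Num.Theory.
Import numFieldNormedType.Exports.
Local Open Scope classical_set_scope.
Local Open Scope ring_scope.

Definition dotv {R : realType} {p : nat} (u v : 'cV[R]_p) : R := (u^T *m v) 0 0.
Definition sqnorm {R : realType} {p : nat} (v : 'cV[R]_p) : R := dotv v v.
Definition Gnorm2 {R : realType} {p : nat} (G : 'M[R]_p) (v : 'cV[R]_p) : R :=
  dotv v (G *m v).

Definition spd {R : realType} {p : nat} (P : 'M[R]_p) : Prop :=
  P^T = P /\ forall v : 'cV[R]_p, v != 0 -> 0 < Gnorm2 P v.

(* the index m (i.e. the ordinal m-1 : 'I_m), for 0 < m *)
Definition last_ix (m : nat) (hm : (0 < m)%N) : 'I_m :=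
  Ordinal (n:=m) (m:=m.-1) (eq_ind_r is_true hm (ltn_predL m)).

(* "i is one of the indices 1..m-1" *)
Definition front {m : nat} (i : 'I_m) : bool := (i.+1 < m)%N.

(* The block matrix G1 (blocks P_i on the diagonal and -rho A_i^T A_j off the
   diagonal, 1 <= i,j <= m-1) is positive definite: R^T G1 R > 0 for every
   nonzero R = (x_1,...,x_{m-1}).  R^T G1 R is written out blockwise. *)
Definition G1_quad {R : realType} {m l : nat} {n : 'I_m -> nat}
  (rho : R) (A : forall i, 'M[R]_(l, n i)) (P : forall i, 'M[R]_(n i))
  (r : forall i, 'cV[R]_(n i)) : R :=
  \sum_(i < m | front i) Gnorm2 (P i) (r i)
  - rho * \sum_(i < m | front i) \sum_(j < m | front j && (j != i))
             dotv (A i *m r i) (A j *m r j).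

Definition G1_posdef {R : realType} {m l : nat} {n : 'I_m -> nat}
  (rho : R) (A : forall i, 'M[R]_(l, n i)) (P : forall i, 'M[R]_(n i)) : Prop :=
  forall r : forall i, 'cV[R]_(n i),
    (exists2 i, front i & r i != 0) -> 0 < G1_quad rho A P r.

Definition theta_sum {R : realType} {m : nat} {n : 'I_m -> nat}
  (theta : forall i, 'cV[R]_(n i) -> R) (u : forall i, 'cV[R]_(n i)) : R :=
  \sum_(i < m) theta i (u i).

Definition Asum {R : realType} {m l : nat} {n : 'I_m -> nat}
  (A : forall i, 'M[R]_(l, n i)) (u : forall i, 'cV[R]_(n i)) : 'cV[R]_l :=
  \sum_(i < m) A i *m u i.

Definition Asum_front {R : realType} {m l : nat} {n : 'I_m -> nat}
  (A : forall i, 'M[R]_(l, n i)) (u : forall i, 'cV[R]_(n i)) : 'cV[R]_l :=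
  \sum_(i < m | front i) A i *m u i.

Definition feasible {R : realType} {m l : nat} {n : 'I_m -> nat}
  (X : forall i, set 'cV[R]_(n i)) (A : forall i, 'M[R]_(l, n i)) (b : 'cV[R]_l)
  (u : forall i, 'cV[R]_(n i)) : Prop :=
  Asum A u = b /\ forall i, X i (u i).

Definition optimal {R : realType} {m l : nat} {n : 'I_m -> nat}
  (theta : forall i, 'cV[R]_(n i) -> R)
  (X : forall i, set 'cV[R]_(n i)) (A : forall i, 'M[R]_(l, n i)) (b : 'cV[R]_l)
  (u : forall i, 'cV[R]_(n i)) : Prop :=
  feasible X A b u /\
  forall v, feasible X A b v -> theta_sum theta u <= theta_sum theta v.

(* (w - w')^T F(w') with F(w') = (-A_1^T y', ..., -A_m^T y', sum_i A_i x'_i - b) *)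
Definition VI_term {R : realType} {m l : nat} {n : 'I_m -> nat}
  (A : forall i, 'M[R]_(l, n i)) (b : 'cV[R]_l)
  (u : forall i, 'cV[R]_(n i)) (y : 'cV[R]_l)
  (u' : forall i, 'cV[R]_(n i)) (y' : 'cV[R]_l) : R :=
  \sum_(i < m) dotv (u i - u' i) (- ((A i)^T *m y'))
  + dotv (y - y') (Asum A u' - b).

Definition in_Wstar {R : realType} {m l : nat} {n : 'I_m -> nat}
  (theta : forall i, 'cV[R]_(n i) -> R)
  (X : forall i, set 'cV[R]_(n i)) (A : forall i, 'M[R]_(l, n i)) (b : 'cV[R]_l)
  (us : forall i, 'cV[R]_(n i)) (ys : 'cV[R]_l) : Prop :=
  (forall i, X i (us i)) /\
  forall (u : forall i, 'cV[R]_(n i)) (y : 'cV[R]_l),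
    (forall i, X i (u i)) ->
    0 <= theta_sum theta u - theta_sum theta us + VI_term A b u y us ys.

Definition is_argmin {R : realType} {T : Type} (S : set T) (f : T -> R) (z : T) : Prop :=
  S z /\ forall x, S x -> f z <= f x.

(* Main.v *)
(* Write [d = x^k - x^(k+1)] and let [V] be the squared [H]-distance to a point of
   [W*], with [H] split into [diag (G_1, P_m)] and a form in [(A_m x_m, y)] that is
   coercive in [y] because [0 < gamma < 2].  Adding the first-order conditions of
   the subproblems to the variational inequality at the solution shows that [V]
   decreases at each step by at least the squared [diag (G_1, P_m)]-norm of [d] plus
   [rho * (2 - gamma)] times the squared residual.  So the iterates are bounded
   while steps and residuals tend to [0].  By continuity of the convex [theta_i],
   a limit along an ultrafilter on [nat] satisfies the variational inequality;
   [V] centred at this limit tends to [0] along the ultrafilter and is monotone,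
   hence tends to [0]. *)

Require Import Defs.
From HB Require Import structures.
From mathcomp Require Import all_boot all_order all_algebra.
From mathcomp Require Import all_classical all_reals all_analysis.
From mathcomp Require Import ring lra.
Import Order.TTheory GRing.Theory Num.Theory.
Import numFieldNormedType.Exports.
Local Open Scope classical_set_scope.
Local Open Scope ring_scope.

Set Implicit Arguments. Unset Strict Implicit. Unset Printing Implicit Defensive.

(** * The Euclidean inner product on column vectors *)

Section InnerProduct.
Context {R : realType}.

Lemma dotvE p (u v : 'cV[R]_p) : dotv u v = \sum_i u i 0 * v i 0.
Proof. by rewrite /dotv mxE; apply: eq_bigr => i _; rewrite mxE. Qed.

Lemma dotvC p (u v : 'cV[R]_p) : dotv u v = dotv v u.
Proof. by rewrite !dotvE; apply: eq_bigr => i _; rewrite mulrC. Qed.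

Lemma dotvDr p (u v w : 'cV[R]_p) : dotv u (v + w) = dotv u v + dotv u w.
Proof. by rewrite /dotv mulmxDr mxE. Qed.

Lemma dotvDl p (u v w : 'cV[R]_p) : dotv (u + v) w = dotv u w + dotv v w.
Proof. by rewrite ![dotv _ w]dotvC dotvDr. Qed.

Lemma dotvZr p a (u v : 'cV[R]_p) : dotv u (a *: v) = a * dotv u v.
Proof. by rewrite /dotv -scalemxAr mxE. Qed.

Lemma dotvZl p a (u v : 'cV[R]_p) : dotv (a *: u) v = a * dotv u v.
Proof. by rewrite ![dotv _ v]dotvC dotvZr. Qed.

Lemma dotvNr p (u v : 'cV[R]_p) : dotv u (- v) = - dotv u v.
Proof. by rewrite -scaleN1r dotvZr mulN1r. Qed.

Lemma dotvNl p (u v : 'cV[R]_p) : dotv (- u) v = - dotv u v.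
Proof. by rewrite ![dotv _ v]dotvC dotvNr. Qed.

Lemma dotv0r p (u : 'cV[R]_p) : dotv u 0 = 0.
Proof. by rewrite -(scale0r 0) dotvZr mul0r. Qed.

Lemma dotv0l p (u : 'cV[R]_p) : dotv 0 u = 0.
Proof. by rewrite dotvC dotv0r. Qed.

Lemma dotv_sumr p (I : Type) (r : seq I) (Q : pred I) (u : 'cV[R]_p) F :
  dotv u (\sum_(i <- r | Q i) F i) = \sum_(i <- r | Q i) dotv u (F i).
Proof.
by apply: (big_morph (dotv u)) => [v w|]; rewrite ?dotvDr ?dotv0r.
Qed.

Lemma dotv_suml p (I : Type) (r : seq I) (Q : pred I) (u : 'cV[R]_p) F :
  dotv (\sum_(i <- r | Q i) F i) u = \sum_(i <- r | Q i) dotv (F i) u.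
Proof. by rewrite dotvC dotv_sumr; apply: eq_bigr => i _; rewrite dotvC. Qed.

Lemma dotv_mull p q (B : 'M[R]_(p, q)) u v :
  dotv (B *m u) v = dotv u (B^T *m v).
Proof. by rewrite /dotv trmx_mul mulmxA. Qed.

Definition dotvL := (dotvDl, dotvDr, dotvNl, dotvNr, dotvZl, dotvZr).

Lemma sqnorm_ge0 p (u : 'cV[R]_p) : 0 <= sqnorm u.
Proof. by rewrite /sqnorm dotvE sumr_ge0// => i _; rewrite -expr2 sqr_ge0. Qed.

Lemma sqnorm_gt0 p (u : 'cV[R]_p) : u != 0 -> 0 < sqnorm u.
Proof.
apply: contra_neqT; rewrite -leNgt => u0.
have {u0}/eqP : sqnorm u = 0 by apply/eqP; rewrite eq_le u0 sqnorm_ge0.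
rewrite /sqnorm dotvE psumr_eq0 => [/allP u0|i _]; last by rewrite -expr2 sqr_ge0.
apply/colP => i; rewrite mxE; apply/eqP.
by have := u0 i (mem_index_enum _); rewrite /= -expr2 sqrf_eq0.
Qed.

Lemma sqr_coord_le p (u : 'cV[R]_p) i : u i 0 ^+ 2 <= sqnorm u.
Proof.
rewrite /sqnorm dotvE (bigD1 i)//= -expr2 lerDl sumr_ge0// => j _.
by rewrite -expr2 sqr_ge0.
Qed.

(** The right side minus the left side is [sqnorm (u - 2 *: v)]. *)
Lemma sqnormB_ge p (u v : 'cV[R]_p) : sqnorm u <= 2 * (sqnorm (u - v) + sqnorm v).
Proof.
have := sqnorm_ge0 (u - 2 *: v).
by rewrite /sqnorm !dotvL (dotvC v u); lra.
Qed.

End InnerProduct.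

(** * Limits of vector-valued maps along an arbitrary filter *)

Section Limits.
Context {R : realType} {T : Type} {F : set_system T} {FF : Filter F}.

Lemma cvg_cV p (v : T -> 'cV[R]_p) (l : 'cV[R]_p) :
  (forall i, v k i 0 @[k --> F] --> l i 0) -> v k @[k --> F] --> l.
Proof.
move=> vl; apply/cvgrPdist_le => e e0.
have H : \forall k \near F, forall i, `|l i 0 - v k i 0| <= e.
  apply: filter_forall => i.
  by have /cvgrPdist_le/(_ _ e0) := vl i.
apply: filterS H => k H; rewrite /Num.Def.normr/= mx_normrE.
apply/bigmax_leP; split; first exact: ltW.
by move=> [i j] _ /=; rewrite !mxE ord1.
Qed.

Lemma cvg_coord p (v : T -> 'cV[R]_p) (l : 'cV[R]_p) i :
  v k @[k --> F] --> l -> v k i 0 @[k --> F] --> l i 0.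
Proof.
by move=> vl; exact: (cvg_comp v (fun M : 'cV_p => M i 0) vl
  (@coord_continuous R p 1 i 0 l)).
Qed.

Lemma cvg_sumr (V : normedModType R) (I : Type) (r : seq I) (Q : pred I)
    (f : I -> T -> V) (l : I -> V) :
  (forall i, Q i -> f i k @[k --> F] --> l i) ->
  \sum_(i <- r | Q i) f i k @[k --> F] --> \sum_(i <- r | Q i) l i.
Proof. by move=> fl; apply: cvg_big => //; exact: add_continuous. Qed.

Lemma cvg_dotv p (u v : T -> 'cV[R]_p) (u0 v0 : 'cV[R]_p) :
  u k @[k --> F] --> u0 -> v k @[k --> F] --> v0 ->
  dotv (u k) (v k) @[k --> F] --> dotv u0 v0.
Proof.
move=> uu vv; rewrite dotvE; under eq_fun do rewrite dotvE.
by apply: cvg_sumr => i _; apply: cvgM; exact: cvg_coord.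
Qed.

Lemma cvg_mulmxr p q (B : 'M[R]_(p, q)) (v : T -> 'cV[R]_q) v0 :
  v k @[k --> F] --> v0 -> B *m v k @[k --> F] --> B *m v0.
Proof.
move=> vv; apply: cvg_cV => i; rewrite mxE; under eq_fun do rewrite mxE.
by apply: cvg_sumr => j _; apply: cvgMr; exact: cvg_coord.
Qed.

(** Bridges the Euclidean estimates and the topology, which comes from the maximum norm: each
    squared coordinate is at most [sqnorm]. *)
Lemma sqnorm_cvg p (v : T -> 'cV[R]_p) (l : 'cV[R]_p) :
  sqnorm (v k - l) @[k --> F] --> 0 -> v k @[k --> F] --> l.
Proof.
move=> v0; apply: cvg_cV => i; apply/cvgrPdist_le => e e0.
have e20 : 0 < e ^+ 2 by rewrite exprn_gt0.
have /cvgrPdist_le/(_ _ e20) := v0; apply: filterS => k.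
rewrite sub0r normrN ger0_norm ?sqnorm_ge0// => /(le_trans (sqr_coord_le _ i)).
by rewrite !mxE => h; rewrite ler_norml; apply/andP; split; nra.
Qed.

End Limits.

(** * Compactness of bounded sets, expressed by ultrafilters *)

Section Ultrafilters.
Context {R : realType} {T : Type} {U : set_system T} {UU : UltraFilter U}.

(** The compact segment supplies a cluster point. For an ultrafilter a cluster point is a limit: if
    the preimage of a neighbourhood were not in [U], its complement would be, and that complement
    misses the neighbourhood. *)
Lemma ultra_cvg_bounded (f : T -> R) M :
  (forall k, `|f k| <= M) -> exists l : R, f k @[k --> U] --> l.
Proof.
move=> fM.
have FM : U (f @^-1` [set` `[- M, M]]).
  by apply: filterE => k; rewrite /= in_itv/= -ler_norml.
have [l [_ lf]] := segment_compact (fmap_proper_filter f _) FM.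
exists l => A Al; have [//|UA] := in_ultra_setVsetC (f @^-1` A) UU.
by have [z [nAz /nAz]] := lf (~` A) A UA Al.
Qed.

Lemma ultra_cvg_sqnorm p (v : T -> 'cV[R]_p) M :
  (forall k, sqnorm (v k) <= M) -> exists l : 'cV[R]_p, v k @[k --> U] --> l.
Proof.
move=> vM.
have H i : exists l : R, v k i 0 @[k --> U] --> l.
  (* The bound [M + 1] avoids a square root, since [t <= t ^+ 2 + 1]. *)
  apply: (@ultra_cvg_bounded _ (M + 1)) => k.
  have := le_trans (sqr_coord_le (v k) i) (vM k).
  rewrite -real_normK ?num_real//; have := normr_ge0 (v k i 0); nra.
have [l ll] := choice H.
by exists (\col_i l i); apply: cvg_cV => i; rewrite mxE.
Qed.

End Ultrafilters.

(** * Continuity of real-valued convex functions in finite dimension *)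

Section Convexity.
Context {R : realType} {p : nat}.
Implicit Types (f : 'cV[R]_p -> R) (S : set 'cV[R]_p).

Lemma convex_functionE f (x y : 'cV[R]_p) t : convex_function setT f ->
  0 <= t <= 1 -> f (t *: x + (1 - t) *: y) <= t * f x + (1 - t) * f y.
Proof.
move=> cf t01.
have := cf (@Itv01 R t (andP t01).1 (andP t01).2) x y.
by rewrite !in_setT => /(_ isT isT).
Qed.

Lemma convex_setE S (x y : 'cV[R]_p) t : convex_set S -> S x -> S y ->
  0 <= t <= 1 -> S (t *: x + (1 - t) *: y).
Proof.
move=> cS Sx Sy t01.
have := cS x y (@Itv01 R t (andP t01).1 (andP t01).2).
by rewrite !inE => /(_ Sx Sy).
Qed.

(** For [t >= 0], [c + t d] lies between [c] and [c + d]; for [t < 0] it lies between [c] and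
    [c - d]. Convexity then bounds the increase of [f] by [|t|] times its increase at that
    endpoint. *)
Lemma convex_ray_ub f c d e : convex_function setT f -> 0 < e ->
  exists2 del, 0 < del & forall t, `|t| <= del -> f (c + t *: d) <= f c + e.
Proof.
move=> cf e0.
(* [K] dominates the increase at both endpoints; the summand 1 keeps it positive, so that [e / K] is
   a legitimate radius. *)
set K := 1 + `|f (c + d) - f c| + `|f (c - d) - f c|.
have a1 := ler_norm (f (c + d) - f c); have a2 := ler_norm (f (c - d) - f c).
have b1 := normr_ge0 (f (c + d) - f c); have b2 := normr_ge0 (f (c - d) - f c).
have K0 : 0 < K by rewrite /K; lra.
exists (Num.min 1 (e / K)); first by rewrite lt_min ltr01 divr_gt0.
move=> t; rewrite le_min ler_pdivlMr// => /andP[t1 tK].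
have [t0|t0] := leP 0 t.
- rewrite ger0_norm// in t1 tK.
  have := @convex_functionE f (c + d) c t cf; rewrite t0 t1 => /(_ isT).
  have -> : t *: (c + d) + (1 - t) *: c = c + t *: d.
    by apply/colP => i; rewrite !mxE; ring.
  by move=> /le_trans; apply; rewrite /K in tK *; nra.
- rewrite ltr0_norm// in t1 tK.
  have := @convex_functionE f (c - d) c (- t) cf.
  have -> : 0 <= - t <= 1 by lra.
  have -> : - t *: (c - d) + (1 - - t) *: c = c + t *: d.
    by apply/colP => i; rewrite !mxE; ring.
  by move=> /(_ isT) /le_trans; apply; rewrite /K in tK *; nra.
Qed.

(* Induct on the coordinates moved: [c + t d + s] is the midpoint of
   [c + 2 t d] and [c + 2 s]. *)
Lemma convex_locally_ub f c e : convex_function setT f -> 0 < e ->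
  exists2 del, 0 < del &
    forall h : 'cV[R]_p, (forall i, `|h i 0| <= del) -> f (c + h) <= f c + e.
Proof.
move=> cf e0.
suff [del d0 H] : exists2 del, 0 < del & forall h : 'I_p -> R,
    (forall i, `|h i| <= del) ->
    f (c + \sum_(i <- index_enum 'I_p) h i *: delta_mx i 0) <= f c + e.
  exists del => // h hd; rewrite [h]matrix_sum_delta.
  under eq_bigr do rewrite big_ord1.
  exact: (H (fun i => h i 0)).
elim: (index_enum _) => [|j s [del d0 IH]].
  by exists 1 => // h _; rewrite big_nil addr0; lra.
have [del1 d10 H1] := @convex_ray_ub f c (delta_mx j 0) e cf e0.
exists (Num.min del del1 / 2) => [|h hd]; first by rewrite divr_gt0// lt_min d0.
have h2 i : `|2 * h i| <= Num.min del del1.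
  by rewrite normrM gtr0_norm// mulrC -ler_pdivlMr.
have {}H1 : f (c + (2 * h j) *: delta_mx j 0) <= f c + e.
  by apply: H1; apply: le_trans (h2 j) _; rewrite ge_min lexx orbT.
have {}IH : f (c + \sum_(i <- s) (2 * h i) *: delta_mx i 0) <= f c + e.
  by apply: IH => i; apply: le_trans (h2 i) _; rewrite ge_min lexx.
have := @convex_functionE f (c + (2 * h j) *: delta_mx j 0)
  (c + \sum_(i <- s) (2 * h i) *: delta_mx i 0) 2^-1 cf.
have -> : 0 <= (2^-1 : R) <= 1 by apply/andP; split; lra.
have -> : 1 - 2^-1 = 2^-1 :> R by field.
have E2 : \sum_(i <- s) (2 * h i) *: delta_mx i 0 =
    2 *: \sum_(i <- s) h i *: delta_mx i 0 :> 'cV[R]_p.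
  by rewrite scaler_sumr; apply: eq_bigr => i _; rewrite scalerA.
rewrite E2 in IH *; rewrite big_cons; set w := \sum_(i <- s) _; set d := delta_mx j 0.
have -> : 2^-1 *: (c + (2 * h j) *: d) + 2^-1 *: (c + 2 *: w) =
    c + (h j *: d + w).
  by apply/colP => i; rewrite !mxE; field.
by move=> /(_ isT) /le_trans; apply; rewrite -/w -/d in H1 IH *; lra.
Qed.

(** A local upper bound suffices: [c] is the midpoint of [x] and its reflection [c + (c - x)], so
    the upper bound at the reflection yields a lower bound at [x]. *)
Lemma convex_function_continuous f : convex_function setT f -> continuous f.
Proof.
move=> cf c; apply: (@cvgrPdist_le _ _ _ _ (nbhs_filter c) f (f c)).2 => e e0.
have [del d0 H] := @convex_locally_ub f c e cf e0.
have cc : x @[x --> c] --> c by exact: cvg_id.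
have := (@cvgrPdist_le _ _ _ _ (nbhs_filter c) (fun x => x) c).1 cc _ d0.
apply: filterS => x; rewrite /Num.Def.normr/= mx_normrE => xd.
have xdi i : `|(c - x) i 0| <= del.
  by apply: le_trans xd; rewrite (le_bigmax _ (fun ij => `|(c - x) ij.1 ij.2|) (i, 0)).
have h1 : f (c + (c - x)) <= f c + e by exact: H.
have h2 : f x <= f c + e.
  rewrite -[x](subrKC c); apply: H => i.
  by rewrite -[x - c]opprB mxE normrN.
have := @convex_functionE f (c + (c - x)) x 2^-1 cf.
have -> : 0 <= (2^-1 : R) <= 1 by apply/andP; split; lra.
have -> : 1 - 2^-1 = 2^-1 :> R by field.
have -> : 2^-1 *: (c + (c - x)) + 2^-1 *: x = c.
  by apply/colP => i; rewrite !mxE; field.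
by move=> /(_ isT) h3; rewrite ler_norml; apply/andP; split; lra.
Qed.

End Convexity.

(** * Coercivity of positive definite forms on families of vectors *)

Section Coercivity.
Context {R : realType} {m : nat} {n : 'I_m -> nat}.
Local Notation fam := (forall i, 'cV[R]_(n i)).

(* Otherwise a normalised sequence on which [q] tends to [0] has, along an
   ultrafilter, a nonzero limit killed by [q]. *)
Lemma posdef_coercive (q : fam -> R) :
  (forall a v, q (fun i => a *: v i) = a ^+ 2 * q v) ->
  (forall (U : set_system nat) (v : nat -> fam) (l : fam), Filter U ->
     (forall i, v k i @[k --> U] --> l i) -> q (v k) @[k --> U] --> q l) ->
  (forall v, (exists i, v i != 0) -> 0 < q v) ->
  exists2 c, 0 < c & forall v, c * \sum_i sqnorm (v i) <= q v.
Proof.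
move=> qZ qC q0; set N := fun v : fam => \sum_i sqnorm (v i).
have N_ge0 v : 0 <= N v by apply: sumr_ge0 => i _; exact: sqnorm_ge0.
have le_N v i : sqnorm (v i) <= N v.
  rewrite /N (bigD1 i)//= lerDl; apply: sumr_ge0 => j _; exact: sqnorm_ge0.
apply: contrapT => nc.
have /choice[v vP] : forall k : nat, exists v, N v = 1 /\ q v <= k.+1%:R^-1.
  move=> k; apply: contrapT => nv; apply: nc.
  (* If no unit family had [q v <= k.+1%:R^-1], then by homogeneity this very number would be a
     coercivity constant. *)
  exists k.+1%:R^-1 => [|v]; first by rewrite invr_gt0.
  rewrite -/(N v); have [->|v0] := eqVneq (N v) 0.
    rewrite mulr0; have [vz|vz] := pselect (exists i, v i != 0).
      exact/ltW/q0.
    have -> : v = fun i => 0 *: v i.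
      apply: functional_extensionality_dep => i; rewrite scale0r.
      by apply: contrapT => /eqP vi; apply: vz; exists i.
    by rewrite qZ expr0n mul0r.
  have Nv : 0 < N v by rewrite lt_def v0 N_ge0.
  rewrite leNgt; apply/negP => qv; apply: nv.
  have s2 : (Num.sqrt (N v))^-1 ^+ 2 = (N v)^-1 by rewrite exprVn sqr_sqrtr.
  exists (fun i => (Num.sqrt (N v))^-1 *: v i); split.
    rewrite /N; under eq_bigr do rewrite /sqnorm !dotvL mulrA -expr2 s2.
    by rewrite -mulr_sumr -/(N v) mulVf.
  by rewrite qZ s2 mulrC ler_pdivrMr// ltW.
have [U [UU ooU]] := @ultraFilterLemma nat \oo _.
have vU i : exists l : 'cV[R]_(n i), v k i @[k --> U] --> l.
  apply: (@ultra_cvg_sqnorm _ _ _ _ _ _ 1) => k.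
  by rewrite -(vP k).1; exact: le_N.
pose l i := sval (cid (vU i)).
have vl i : v k i @[k --> U] --> l i := svalP (cid (vU i)).
have ql : q l <= 0.
  have k0 : k.+1%:R^-1 @[k --> U] --> (0 : R).
    exact: cvg_trans (cvg_app _ ooU) (@cvg_harmonic R).
  apply: (ler_cvg_to (qC U v l _ vl) k0); apply: filterE => k.
  exact: (vP k).2.
have Nl : N l = 1.
  have : N (v k) @[k --> U] --> N l.
    by apply: cvg_sumr => i _; exact: (cvg_dotv (vl i) (vl i)).
  under eq_fun do rewrite (vP _).1.
  by move=> N1; exact: (cvg_unique (@norm_hausdorff _ _) N1 (cvg_cst _)).
have [i li] : exists i, l i != 0.
  apply: contrapT => nl; move: Nl; rewrite /N big1 ?eqxx => [/eqP|i _].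
    by rewrite eq_sym oner_eq0.
  suff -> : l i = 0 by rewrite /sqnorm dotv0l.
  by apply: contrapT => /eqP li; apply: nl; exists i.
by have := q0 l (ex_intro _ i li); rewrite ltNge ql.
Qed.

End Coercivity.

(** * First-order optimality condition of a proximal subproblem *)

Lemma affine_ge0_at0 (R : realType) (D C : R) :
  (forall t, 0 < t <= 1 -> 0 <= D + t * C) -> 0 <= D.
Proof.
move=> H; rewrite leNgt; apply/negP => D0.
have C1 : 0 < 1 + `|C| by rewrite addrC ltr_wpDl.
have CC := ler_norm C; have C0 := normr_ge0 C.
(* If [D < 0], this [t] makes [t * C] at most [- D / 2], hence [D + t * C] negative. *)
pose t := Num.min 1 (- D / (2 * (1 + `|C|))).
have D1 : 0 < - D / (2 * (1 + `|C|)) by rewrite divr_gt0 ?mulr_gt0// oppr_gt0.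
have t0 : 0 < t by rewrite lt_min ltr01.
have t1 : t <= 1 by rewrite ge_min lexx.
have tD : t * (2 * (1 + `|C|)) <= - D.
  by rewrite -ler_pdivlMr ?mulr_gt0// ge_min lexx orbT.
have := H t; rewrite t0 t1 => /(_ isT); nra.
Qed.

(** Compare the minimiser [x] with [x + t (z - x)], which stays in [S]. Convexity of [f] bounds its
    variation by [t (f z - f x)]; after division by [t], the quadratic terms contribute only a
    multiple of [t], and [affine_ge0_at0] removes it. The hypothesis on [c] says that it is affine
    with linear part [B]. *)
Lemma prox_VI (R : realType) p l (S : set 'cV[R]_p) (f : 'cV[R]_p -> R)
    (B : 'M[R]_(l, p)) (c : 'cV[R]_p -> 'cV[R]_l) (Q : 'M[R]_p) x0 rho x :
  convex_set S -> convex_function setT f -> Q^T = Q ->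
  (forall z, c z = c x + B *m (z - x)) ->
  is_argmin S
    (fun z => f z + rho / 2 * sqnorm (c z) + 2^-1 * Gnorm2 Q (z - x0)) x ->
  forall z, S z ->
    0 <= f z - f x + rho * dotv (B *m (z - x)) (c x)
         + dotv (z - x) (Q *m (x - x0)).
Proof.
move=> cS cf Qsym cE [Sx xmin] z Sz.
set h := z - x.
apply: (@affine_ge0_at0 _ _ (rho / 2 * sqnorm (B *m h) + 2^-1 * Gnorm2 Q h)).
move=> t /andP[t0 t1].
have t01 : 0 <= t <= 1 by rewrite ltW.
have := xmin _ (convex_setE cS Sz Sx t01).
have := convex_functionE z x cf t01.
have -> : t *: z + (1 - t) *: x = x + t *: h.
  by apply/colP => i; rewrite !mxE; ring.
have -> : c (x + t *: h) = c x + t *: (B *m h).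
  by rewrite cE addrAC subrr add0r -scalemxAr.
have -> : x + t *: h - x0 = (x - x0) + t *: h by rewrite addrAC.
move: (x - x0) => w.
have Qwh : dotv w (Q *m h) = dotv h (Q *m w).
  by rewrite dotvC dotv_mull Qsym.
have QE : Q *m (w + t *: h) = Q *m w + t *: (Q *m h).
  by rewrite mulmxDr -scalemxAr.
clearbody h; rewrite /Gnorm2 /sqnorm QE !dotvL Qwh (dotvC (B *m h) (c x)).
move: (f _) (f z) (f x) => f1 f2 f3 h1 h2.
rewrite -(pmulr_rge0 _ t0); lra.
Qed.

(** * The bilinear form of the primal blocks *)

Section BlockForm.
Context {R : realType} {m l : nat} (hm : (0 < m)%N) {n : 'I_m -> nat}.
Context (rho : R) (A : forall i, 'M[R]_(l, n i)) (P : forall i, 'M[R]_(n i)).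
Local Notation fam := (forall i, 'cV[R]_(n i)).
Local Notation mm := (last_ix hm).
Implicit Types u v w : fam.

Lemma front_last (i : 'I_m) : front i = (i != mm).
Proof.
rewrite /front -val_eqE/=; have := ltn_ord i; move: (i : nat) => k.
by case: m hm => //= m' _; rewrite !ltnS leq_eqVlt; case: ltngtP.
Qed.

Lemma sum_front_last (V : nmodType) (F : 'I_m -> V) :
  \sum_i F i = \sum_(i | front i) F i + F mm.
Proof.
rewrite (bigD1 mm)//= addrC; congr (_ + _).
by apply: eq_bigl => i; rewrite front_last.
Qed.

Lemma Asum_frontB u v :
  Asum_front A (fun i => u i - v i) = Asum_front A u - Asum_front A v.
Proof. by rewrite /Asum_front -sumrB; apply: eq_bigr => i _; rewrite mulmxBr. Qed.

Lemma AsumE u : Asum A u = Asum_front A u + A mm *m u mm.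
Proof. exact: sum_front_last. Qed.

(* The form with matrix diag(G_1, P_m). *)
Definition blockform u v : R :=
  \sum_(i < m) dotv (u i) (P i *m v i)
  - rho * \sum_(i < m | front i) \sum_(j < m | front j && (j != i))
             dotv (A i *m u i) (A j *m v j).

Lemma blockform_diag u :
  blockform u u = G1_quad rho A P u + Gnorm2 (P mm) (u mm).
Proof. by rewrite /blockform sum_front_last addrAC. Qed.

Lemma blockformC u v : (forall i, (P i)^T = P i) ->
  blockform u v = blockform v u.
Proof.
move=> Psym; rewrite /blockform; congr (_ - rho * _).
  by apply: eq_bigr => i _; rewrite dotvC dotv_mull Psym.
rewrite (exchange_big_dep front)/= => [|i j _ /andP[]//].
apply: eq_bigr => i fi; apply: eq_big => [j|j _]; last exact: dotvC.
by rewrite fi eq_sym.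
Qed.

Lemma blockformDr u v w :
  blockform u (fun i => v i + w i) = blockform u v + blockform u w.
Proof.
rewrite /blockform addrACA -opprD -mulrDr -!big_split/=.
congr (_ - rho * _); apply: eq_bigr => i _.
  by rewrite mulmxDr dotvDr.
by rewrite -big_split; apply: eq_bigr => j _; rewrite mulmxDr dotvDr.
Qed.

Lemma blockformZr a u v :
  blockform u (fun i => a *: v i) = a * blockform u v.
Proof.
rewrite /blockform mulrBr (mulrCA a) !mulr_sumr; congr (_ - _).
  by apply: eq_bigr => i _; rewrite -scalemxAr dotvZr.
apply: eq_bigr => i _; congr (rho * _); rewrite mulr_sumr.
by apply: eq_bigr => j _; rewrite -scalemxAr dotvZr.
Qed.

Lemma cvg_blockform (T : Type) (F : set_system T) (FF : Filter F)
    (u v : T -> fam) (u0 v0 : fam) :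
  (forall i, u k i @[k --> F] --> u0 i) ->
  (forall i, v k i @[k --> F] --> v0 i) ->
  blockform (u k) (v k) @[k --> F] --> blockform u0 v0.
Proof.
move=> uu vv; rewrite /blockform; apply: cvgB.
  by apply: cvg_sumr => i _; apply: cvg_dotv (uu i) _; exact: cvg_mulmxr.
apply: cvgMr; apply: cvg_sumr => i _; apply: cvg_sumr => j _.
by apply: cvg_dotv; exact: cvg_mulmxr.
Qed.

Context (Pspd : forall i, spd (P i)).
Context (G1pd : G1_posdef rho A P).

Let Psym i : (P i)^T = P i. Proof. by have [] := Pspd i. Qed.

Lemma blockformDD u v :
  blockform (fun i => u i + v i) (fun i => u i + v i) =
  blockform u u + 2 * blockform u v + blockform v v.
Proof.
rewrite blockformDr !(blockformC (fun i => _ + _))// !blockformDr.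
by rewrite (blockformC v u)//; ring.
Qed.

(** If a front block is nonzero, [G1_posdef] gives strict positivity and the last term is
    nonnegative. Otherwise only the last block survives, and its matrix is positive definite. *)
Lemma blockform_gt0 v : (exists i, v i != 0) -> 0 < blockform v v.
Proof.
move=> [i vi].
have Pm : 0 <= Gnorm2 (P mm) (v mm).
  have [->|vm] := eqVneq (v mm) 0; first by rewrite /Gnorm2 dotv0l.
  by have [_ /(_ _ vm)/ltW] := Pspd mm.
have [[j fj vj]|nv] := pselect (exists2 j, front j & v j != 0).
  by rewrite blockform_diag ltr_wpDr// G1pd//; exists j.
have v0 j : front j -> v j = 0.
  by move=> fj; apply: contrapT => /eqP vj; apply: nv; exists j.
have im : i = mm.
  by apply/eqP; apply: contraT; rewrite -front_last => /v0 /eqP; rewrite (negbTE vi).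
rewrite blockform_diag /G1_quad big1 => [|j fj]; last by rewrite v0// /Gnorm2 dotv0l.
rewrite big1 => [|j fj].
  by rewrite mulr0 subr0 add0r -im; have [_] := Pspd i; exact.
by apply: big1 => k _; rewrite v0// mulmx0 dotv0l.
Qed.

Lemma blockform_coercive :
  exists2 c, 0 < c & forall v, c * \sum_i sqnorm (v i) <= blockform v v.
Proof.
apply: posdef_coercive => [a v|U v w FU vw|v]; last exact: blockform_gt0.
- by rewrite blockformZr blockformC// blockformZr mulrA.
- exact: cvg_blockform.
Qed.

End BlockForm.

(** * Solutions of the variational inequality, and the effect of one iteration *)

Section Step.
Context {R : realType} {m l : nat} (hm : (0 < m)%N) {n : 'I_m -> nat}.
Context (theta : forall i, 'cV[R]_(n i) -> R) (X : forall i, set 'cV[R]_(n i)).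
Context (A : forall i, 'M[R]_(l, n i)) (b : 'cV[R]_l).
Context (rho gamma : R) (P : forall i, 'M[R]_(n i)).
Local Notation fam := (forall i, 'cV[R]_(n i)).
Local Notation mm := (last_ix hm).
Local Notation B := (blockform rho A P).
Arguments theta : clear implicits.
Arguments X : clear implicits.

Lemma VI_termE (u us : fam) (y ys : 'cV[R]_l) :
  VI_term A b u y us ys =
  - dotv (Asum A (fun i => u i - us i)) ys + dotv (y - ys) (Asum A us - b).
Proof.
rewrite /VI_term /Asum dotv_suml -sumrN; congr (_ + _).
by apply: eq_bigr => i _; rewrite dotvNr dotv_mull.
Qed.

Lemma Wstar_feasible us ys : in_Wstar theta X A b us ys -> Asum A us = b.
Proof.
move=> [Xus VI]; apply/eqP; rewrite -subr_eq0; apply: contraT => /sqnorm_gt0.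
(* Testing with a dual point moved against the constraint violation gives
   [0 <= - sqnorm (Asum A us - b)]. *)
have := VI us (ys - (Asum A us - b)) Xus.
rewrite subrr add0r VI_termE (_ : Asum A _ = 0); last first.
  by rewrite /Asum big1// => i _; rewrite subrr mulmx0.
rewrite dotv0l oppr0 add0r addrAC subrr add0r dotvNl /sqnorm.
by rewrite oppr_ge0 => /le_lt_trans h /h; rewrite ltxx.
Qed.

(** For a feasible [v] and the dual point [ys], the term [VI_term] vanishes, so the variational
    inequality reduces to comparing objectives. *)
Lemma Wstar_optimal us ys : in_Wstar theta X A b us ys ->
  optimal theta X A b us.
Proof.
move=> W; have us_feas := Wstar_feasible W; have [Xus VI] := W.
split=> // v [Av Xv]; have := VI v ys Xv.
rewrite VI_termE subrr dotv0l addr0 (_ : Asum A _ = 0) ?dotv0l ?oppr0 ?addr0 ?subr_ge0//.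
rewrite -[RHS](subrr b) -{1}Av -us_feas /Asum -sumrB.
by apply: eq_bigr => i _; rewrite mulmxBr.
Qed.

Definition lgadmm_step (x : fam) (y : 'cV[R]_l) (x' : fam) (y' : 'cV[R]_l) :=
  [/\ forall j : 'I_m, front j ->
        is_argmin (X j)
          (fun z => theta j z
             + rho / 2 * sqnorm (A j *m z + \sum_(i < m | i != j) A i *m x i
                                 - b - rho^-1 *: y)
             + 2^-1 * Gnorm2 (P j) (z - x j)) (x' j),
      is_argmin (X mm)
        (fun z => theta mm z
           + rho / 2 * sqnorm (gamma *: Asum_front A x'
                               + (1 - gamma) *: (b - A mm *m x mm)
                               + A mm *m z - b - rho^-1 *: y)
           + 2^-1 * Gnorm2 (P mm) (z - x mm)) (x' mm) &
      y' = y - rho *: (gamma *: Asum_front A x'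
                       + (1 - gamma) *: (b - A mm *m x mm)
                       + A mm *m x' mm - b)].

Context (theta_conv : forall i, convex_function setT (theta i)).
Context (X_conv : forall i, @convex_set R 'cV[R]_(n i) (X i)).
Context (rho0 : 0 < rho).
Context (gamma02 : 0 < gamma < 2).
Context (Pspd : forall i, spd (P i)).

Let Psym i : (P i)^T = P i. Proof. by have [] := Pspd i. Qed.

(** Front blocks are new and the last block is old, so that [y - rho *: residual x x'] is the
    auxiliary multiplier [\bar y^k]. *)
Definition residual (x x' : fam) := Asum_front A x' + A mm *m x mm - b.

(** Sum of the optimality conditions of all the subproblems. The front blocks see the auxiliary
    multiplier, the last block sees [y'], and the proximal and coupling terms together form [B]. *)
Lemma step_VI x y x' y' : lgadmm_step x y x' y' ->
  forall u : fam, (forall i, X i (u i)) ->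
  0 <= theta_sum theta u - theta_sum theta x'
       - dotv (Asum_front A (fun i => u i - x' i)) (y - rho *: residual x x')
       - dotv (A mm *m (u mm - x' mm)) y'
       - B (fun i => u i - x' i) (fun i => x i - x' i).
Proof.
move=> [xj xm yE] u Xu; set h := fun i => u i - x' i; set d := fun i => x i - x' i.
set yb := y - _.
have rn0 : rho != 0 by rewrite gt_eqF.
have Hj j : front j -> 0 <= theta j (u j) - theta j (x' j)
    - dotv (A j *m h j) yb
    + rho * (\sum_(i < m | front i && (i != j)) dotv (A j *m h j) (A i *m d i))
    - dotv (h j) (P j *m d j).
  move=> fj.
  have := prox_VI (@X_conv j) (@theta_conv j) (Psym j) _ (xj j fj) (Xu j).
  move=> /(_ (A j) _); set c := (X in dotv _ X).
  (* The front blocks are updated in parallel, so subproblem [j] uses the old values of the others;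
     replacing them by the new ones costs the steps [A i *m d i] with [i != j]. *)
  have cE : rho *: c = - yb + rho *: \sum_(i < m | front i && (i != j)) A i *m d i.
    have -> : \sum_(i < m | front i && (i != j)) A i *m d i =
        \sum_(i < m | front i && (i != j)) A i *m x i -
        \sum_(i < m | front i && (i != j)) A i *m x' i.
      by rewrite -sumrB; apply: eq_bigr => i _; rewrite mulmxBr.
    rewrite /c /yb /residual (bigD1 mm)/=; last by rewrite eq_sym -front_last.
    rewrite (eq_bigl (fun i => front i && (i != j))); last first.
      by move=> i; rewrite (front_last hm) andbC.
    have -> : Asum_front A x' =
        A j *m x' j + \sum_(i < m | front i && (i != j)) A i *m x' i.
      exact: (bigD1 j fj).
    by apply/colP => i; rewrite !mxE; field.
  rewrite -dotvZr cE dotvDr dotvNr dotvZr dotv_sumr -/(h j).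
  have -> : x' j - x j = - d j by rewrite opprB.
  rewrite mulmxN dotvNr.
  move=> /(_ _)/le_trans; apply => [z|]; last by rewrite !addrA.
  by rewrite mulmxBr; apply/colP => i; rewrite !mxE; ring.
have Hm : 0 <= theta mm (u mm) - theta mm (x' mm)
    - dotv (A mm *m h mm) y' - dotv (h mm) (P mm *m d mm).
  have := prox_VI (@X_conv mm) (@theta_conv mm) (Psym mm) _ xm (Xu mm).
  move=> /(_ (A mm) _); set c := (X in dotv _ X).
  (* The multiplier update has the same argument as the penalty of the last subproblem. *)
  have cE : rho *: c = - y'.
    by rewrite /c yE; apply/colP => i; rewrite !mxE; field.
  rewrite -dotvZr cE dotvNr -/(h mm).
  have -> : x' mm - x mm = - d mm by rewrite opprB.
  rewrite mulmxN dotvNr.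
  move=> /(_ _)/le_trans; apply => [z|]; last exact: lexx.
  by rewrite mulmxBr; apply/colP => i; rewrite !mxE; ring.
(* Summed over the front indices, the coupling terms become the off-diagonal part of [B]. *)
have := addr_ge0 (sumr_ge0 (index_enum 'I_m) Hj) Hm.
rewrite !big_split/= !sumrN -mulr_sumr /blockform /theta_sum !(sum_front_last hm).
rewrite /Asum_front dotv_suml; lra.
Qed.

(* The [(x_m, y)]-block of [H], apart from [P_m], evaluated at [(x_m, eta)]
   with [a = A_m x_m]. *)
Definition dualform (a eta : 'cV[R]_l) : R :=
  rho / gamma * sqnorm a + 2 * (1 - gamma) / gamma * dotv a eta
  + (gamma * rho)^-1 * sqnorm eta.

Let g0 : 0 < gamma. Proof. by case/andP: gamma02. Qed.
Let g2 : 0 < 2 - gamma. Proof. by rewrite subr_gt0; case/andP: gamma02. Qed.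

(** Completing the square in [eta]; the leftover coefficient of [sqnorm a] is positive exactly
    because [gamma < 2]. *)
Lemma dualform_sos a eta : dualform a eta =
  (gamma * rho)^-1 * sqnorm (eta - (rho * (gamma - 1)) *: a)
  + rho * (2 - gamma) * sqnorm a.
Proof.
have := g0; have := rho0; rewrite /dualform /sqnorm !dotvL (dotvC eta a).
by move=> ? ?; field; rewrite !gt_eqF.
Qed.

Lemma dualform_ge0 a eta : 0 <= dualform a eta.
Proof.
have := g0; have := g2; have := rho0 => ? ? ?.
by rewrite dualform_sos addr_ge0 ?mulr_ge0 ?sqnorm_ge0 ?invr_ge0 ?ltW ?mulr_gt0.
Qed.

Lemma dualform_coercive :
  exists K, forall a eta, sqnorm eta <= K * dualform a eta.
Proof.
have := g0; have := g2; have := rho0 => r0 g2' g0'.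
(* From [sqnorm eta <= 2 * (sqnorm (eta - w) + sqnorm w)], each summand of the constant compensates
   one of the two coefficients in [dualform_sos]. *)
exists (2 * (gamma * rho) + 2 * (rho * (gamma - 1) ^+ 2 / (2 - gamma))) => a eta.
set w := (rho * (gamma - 1)) *: a.
apply: le_trans (sqnormB_ge eta w) _.
rewrite dualform_sos -/w.
have -> : sqnorm w = (rho * (gamma - 1)) ^+ 2 * sqnorm a.
  by rewrite /sqnorm /w !dotvL mulrA expr2.
have := sqnorm_ge0 (eta - w); have := sqnorm_ge0 a.
move: (sqnorm a) (sqnorm (eta - w)) => s t s0 t0.
rewrite -subr_ge0.
(* The matching products cancel, and [g] is the sum of the two cross products. *)
set g := (X in 0 <= X).
have -> : g = 2 * (gamma * rho) * (rho * (2 - gamma) * s)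
   + 2 * (gamma - 1) ^+ 2 / ((2 - gamma) * gamma) * t.
  by rewrite /g; field; rewrite !gt_eqF.
have r0' := ltW r0; have g2'' := ltW g2'; have g0'' := ltW g0'.
apply: addr_ge0; first by do !apply: mulr_ge0.
apply: mulr_ge0 => //; apply: divr_ge0; last exact: mulr_ge0.
by apply: mulr_ge0; rewrite ?sqr_ge0.
Qed.

(** To be read with [a] the new error of [A_m x_m], [p] its last decrement, [r] the residual and
    [eta] the old dual error. Then [r - p - a] is the error of the front sum, and the bracket
    collects exactly the multiplier terms of the two variational inequalities. *)
Lemma dualform_step a p r eta :
  dualform (a + p) eta - dualform a (eta - rho *: (gamma *: r - p)) =
  2 * (dotv (r - p - a) (eta - rho *: r)
       + dotv a (eta - rho *: (gamma *: r - p)))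
  + rho * (2 - gamma) * sqnorm r.
Proof.
have := g0; have := rho0 => ? ?.
rewrite /dualform /sqnorm !dotvL (dotvC p a) (dotvC r p).
rewrite ?(dotvC r a) ?(dotvC eta a) ?(dotvC eta p) ?(dotvC eta r).
by field; rewrite !gt_eqF.
Qed.

Definition lyap (us : fam) (ys : 'cV[R]_l) (x : fam) (y : 'cV[R]_l) :=
  B (fun i => x i - us i) (fun i => x i - us i)
  + dualform (A mm *m (x mm - us mm)) (y - ys).

(** Add [step_VI] at [us] to the solution's inequality at [x']: the objectives cancel, leaving
    [B e d] plus multiplier terms nonnegative. Twice this sum is the change of [lyap] minus the two
    gain terms, by [dualform_step] and the expansion of [B] at [e + d]. *)
Lemma lyap_decrease us ys x y x' y' : in_Wstar theta X A b us ys ->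
  (forall i, X i (x' i)) -> lgadmm_step x y x' y' ->
  lyap us ys x' y' + B (fun i => x i - x' i) (fun i => x i - x' i)
  + rho * (2 - gamma) * sqnorm (residual x x') <= lyap us ys x y.
Proof.
move=> W Xx' st; have us_feas := Wstar_feasible W; have [Xus VI] := W.
have := step_VI st Xus; have [_ _ yE] := st.
have := VI x' ys Xx'.
rewrite VI_termE subrr dotv0l addr0 (AsumE hm) Asum_frontB dotvDl.
rewrite Asum_frontB.
have fus : Asum_front A us = b - A mm *m us mm.
  by rewrite -us_feas (AsumE hm) addrK.
set r := residual x x'; set a := A mm *m (x' mm - us mm).
set p := A mm *m (x mm - x' mm); set eta := y - ys.
set e := fun i => x' i - us i; set d := fun i => x i - x' i.
have aE : A mm *m (us mm - x' mm) = - a by rewrite -mulmxN opprB.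
have Ee : Asum_front A x' - Asum_front A us = r - p - a.
  rewrite fus /r /p /a /residual !mulmxBr.
  by apply/colP => i; rewrite !mxE; ring.
have Eb : B (fun i => us i - x' i) d = - B e d.
  rewrite (_ : (fun i => us i - x' i) = (fun i => (-1) *: e i)); last first.
    by apply: functional_extensionality_dep => i; rewrite scaleN1r opprB.
  by rewrite blockformC// blockformZr mulN1r blockformC.
have Ey' : y' - ys = eta - rho *: (gamma *: r - p).
  rewrite yE /eta /r /p /residual !mulmxBr.
  by apply/colP => i; rewrite !mxE; ring.
have Exus : (fun i => x i - us i) = (fun i => e i + d i).
  by apply: functional_extensionality_dep => i; rewrite /e /d [RHS]addrC subrKA.
have BDD : B (fun i => e i + d i) (fun i => e i + d i) =
  B e e + 2 * B e d + B d d by exact: blockformDD.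
rewrite Ee aE Eb /lyap Exus BDD Ey' -/e.
have -> : A mm *m (x mm - us mm) = a + p.
  by rewrite /a /p -mulmxDr [X in _ = _ *m X]addrC subrKA.
have := dualform_step a p r eta.
have -> : y' = ys + (eta - rho *: (gamma *: r - p)) by rewrite -Ey' addrC subrK.
have -> : y - rho *: r = ys + (eta - rho *: r).
  by rewrite /eta addrA addrCA subrr addr0.
have -> : Asum_front A us - Asum_front A x' = - (r - p - a) by rewrite -Ee opprB.
rewrite -/a -/e !(dotvNl, dotvDr _ ys).
move: (dualform _ _) (dualform _ _) => V V' E h1 h2.
lra.
Qed.

End Step.

(** * From decrease to convergence *)

Lemma nonincreasing_cvg0_finer (R : realType) (U : set_system nat)
    (UF : ProperFilter U) (V : nat -> R) :
  (forall k, V k.+1 <= V k) -> (forall k, 0 <= V k) ->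
  V k @[k --> U] --> (0 : R) -> V @ \oo --> (0 : R).
Proof.
move=> Vdec V0 VU; have {}Vdec : nonincreasing_seq V by exact/nonincreasing_seqP.
apply/cvgrPdist_le => e e0.
(* A single index with [V K <= e] is enough: monotonicity carries the bound to all later indices. *)
have /cvgrPdist_le/(_ _ e0)/filter_ex[K] := VU.
rewrite sub0r normrN ger0_norm// => VK.
exists K => // k /= Kk; rewrite sub0r normrN ger0_norm//.
exact: le_trans (Vdec _ _ Kk) VK.
Qed.

Section Convergence.
Context {R : realType} {m l : nat} (hm : (0 < m)%N) {n : 'I_m -> nat}.
Context (theta : forall i, 'cV[R]_(n i) -> R) (X : forall i, set 'cV[R]_(n i)).
Context (A : forall i, 'M[R]_(l, n i)) (b : 'cV[R]_l).
Context (rho gamma : R) (P : forall i, 'M[R]_(n i)).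
Arguments theta : clear implicits.
Arguments X : clear implicits.
Local Notation fam := (forall i, 'cV[R]_(n i)).
Local Notation mm := (last_ix hm).
Local Notation B := (blockform rho A P).
Context (theta_conv : forall i, convex_function setT (theta i)).
Context (X_conv : forall i, @convex_set R 'cV[R]_(n i) (X i)).
Context (X_closed : forall i, closed (X i)).
Context (rho0 : 0 < rho).
Context (gamma02 : 0 < gamma < 2).
Context (Pspd : forall i, spd (P i)).
Context (G1pd : G1_posdef rho A P).
Context (x : nat -> fam) (y : nat -> 'cV[R]_l).
Context (xX : forall k i, X i (x k i)).
Context (xstep : forall k,
  lgadmm_step hm theta X A b rho gamma P (x k) (y k) (x k.+1) (y k.+1)).

Let V us ys k := lyap hm A rho gamma P us ys (x k) (y k).
Let d k i := x k i - x k.+1 i.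
Let r k := residual hm A b (x k) (x k.+1).

Lemma blockform_ge0 v : 0 <= B v v.
Proof.
have [c c0 /(_ v)] := blockform_coercive hm Pspd G1pd.
apply: le_trans; apply: mulr_ge0; first exact: ltW.
by apply: sumr_ge0 => i _; exact: sqnorm_ge0.
Qed.

Lemma lyap_ge0 us ys k : 0 <= V us ys k.
Proof. by rewrite addr_ge0 ?blockform_ge0 ?dualform_ge0. Qed.

Lemma sqnorm_le_blockform :
  exists K, forall v i, sqnorm (v i) <= K * B v v.
Proof.
have [c c0 H] := blockform_coercive hm Pspd G1pd.
exists c^-1 => v i; rewrite ler_pdivlMl//; apply: le_trans (H v).
rewrite ler_pM2l// (bigD1 i)//= lerDl sumr_ge0// => j _; exact: sqnorm_ge0.
Qed.

Lemma lyap_bound : exists K, forall us ys k,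
  (forall i, sqnorm (x k i - us i) <= K * V us ys k) /\
  sqnorm (y k - ys) <= K * V us ys k.
Proof.
have [K1 H1] := sqnorm_le_blockform.
have [K2 H2] := dualform_coercive (l := l) rho0 gamma02.
(* Absolute values make the constant nonnegative, and the sum serves the primal and the dual bound
   at once. *)
exists (`|K1| + `|K2|) => us ys k.
have B0 := blockform_ge0 (fun i => x k i - us i).
have D0 := dualform_ge0 rho0 gamma02 (A mm *m (x k mm - us mm)) (y k - ys).
have [k1 k2] := (ler_norm K1, ler_norm K2).
have [k10 k20] := (normr_ge0 K1, normr_ge0 K2).
split=> [i|].
  apply: le_trans (H1 (fun i => x k i - us i) i) _.
  rewrite /V /lyap; nra.
apply: le_trans (H2 (A mm *m (x k mm - us mm)) (y k - ys)) _.
rewrite /V /lyap; nra.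
Qed.

Lemma lyap_dec us ys k : in_Wstar theta X A b us ys ->
  V us ys k.+1 + B (d k) (d k) + rho * (2 - gamma) * sqnorm (r k) <= V us ys k.
Proof. by move=> W; apply: (lyap_decrease _ _ _ _ _ W) => //; exact: xX. Qed.

Let rg : 0 < rho * (2 - gamma).
Proof. by rewrite mulr_gt0 ?subr_gt0//; case/andP: gamma02. Qed.

Lemma lyap_noninc us ys k : in_Wstar theta X A b us ys ->
  V us ys k.+1 <= V us ys k.
Proof.
move=> W; apply: le_trans (lyap_dec k W).
by rewrite -addrA lerDl addr_ge0 ?blockform_ge0// mulr_ge0 ?sqnorm_ge0// ltW.
Qed.

(** * Vanishing steps and ultrafilter limits, given one solution *)

Section GivenSolution.
Context (us : fam) (ys : 'cV[R]_l) (W : in_Wstar theta X A b us ys).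

(** [V] is nonincreasing and bounded below, hence convergent, so consecutive values have the same
    limit. These differences dominate the steps and residuals. *)
Lemma lyap_diff_cvg0 : V us ys k - V us ys k.+1 @[k --> \oo] --> (0 : R).
Proof.
have cV : cvgn (V us ys).
  apply: nonincreasing_is_cvgn.
    by apply/nonincreasing_seqP => k; exact: lyap_noninc.
  by exists 0 => _ [k _ <-]; exact: lyap_ge0.
rewrite -(subrr (limn (V us ys))); apply: cvgB => //.
by move: cV; rewrite -(cvg_shiftS (V us ys)).
Qed.

Lemma steps_cvg0 i : d k i @[k --> \oo] --> (0 : 'cV[R]_(n i)).
Proof.
apply: sqnorm_cvg.
have [K HK] := sqnorm_le_blockform.
have K0 : 0 <= `|K| := normr_ge0 K.
apply: (@squeeze_cvgr _ _ _ _ (fun=> 0) (fun k => `|K| * (V us ys k - V us ys k.+1))).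
- apply: nearW => k; rewrite sqnorm_ge0 subr0/=.
  apply: le_trans (HK _ _) _; apply: le_trans (_ : `|K| * B (d k) (d k) <= _).
    by rewrite ler_wpM2r ?blockform_ge0 ?ler_norm.
  rewrite ler_wpM2l// lerBrDl; apply: le_trans (lyap_dec k W).
  by rewrite lerDl mulr_ge0 ?sqnorm_ge0// ltW.
- exact: cvg_cst.
- by rewrite -(mulr0 `|K|); apply: cvgMr; exact: lyap_diff_cvg0.
Qed.

Lemma residual_cvg0 : r k @[k --> \oo] --> (0 : 'cV[R]_l).
Proof.
apply: sqnorm_cvg.
apply: (@squeeze_cvgr _ _ _ _ (fun=> 0)
  (fun k => (rho * (2 - gamma))^-1 * (V us ys k - V us ys k.+1))).
- apply: nearW => k; rewrite sqnorm_ge0 subr0/= ler_pdivlMl// lerBrDl.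
  apply: le_trans (lyap_dec k W).
  by rewrite lerD2r lerDl blockform_ge0.
- exact: cvg_cst.
- by rewrite -[X in _ --> X](mulr0 (rho * (2 - gamma))^-1); apply: cvgMr;
    exact: lyap_diff_cvg0.
Qed.

Lemma iterates_ultra_cvg (U : set_system nat) (UU : UltraFilter U) :
  (forall i, exists z : 'cV[R]_(n i), x k i @[k --> U] --> z) /\
  exists z : 'cV[R]_l, y k @[k --> U] --> z.
Proof.
have [K HK] := lyap_bound.
have V0 k : V us ys k <= V us ys 0%N.
  by elim: k => // k; apply: le_trans; exact: lyap_noninc.
have KV k : K * V us ys k <= `|K| * V us ys 0%N.
  apply: le_trans (_ : `|K| * V us ys k <= _).
    by rewrite ler_wpM2r ?lyap_ge0 ?ler_norm.
  by rewrite ler_wpM2l.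
split=> [i|].
- have [|z zP] := @ultra_cvg_sqnorm _ _ U _ _ (fun k => x k i - us i)
    (`|K| * V us ys 0%N).
    by move=> k; apply: le_trans (KV k); have [] := HK us ys k.
  exists (z + us i); rewrite (_ : (fun k => x k i) = (fun k => x k i - us i + us i)).
    by apply: cvgD => //; exact: cvg_cst.
  by apply/funext => k; rewrite subrK.
- have [|z zP] := @ultra_cvg_sqnorm _ _ U _ _ (fun k => y k - ys)
    (`|K| * V us ys 0%N).
    by move=> k; apply: le_trans (KV k); have [] := HK us ys k.
  exists (z + ys); rewrite (_ : y = (fun k => y k - ys + ys)).
    by apply: cvgD => //; exact: cvg_cst.
  by apply/funext => k; rewrite subrK.
Qed.

(** Pass to the limit in [step_VI]: vanishing steps kill the [B] term, and vanishing residuals bring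
    both multipliers to [yinf]. *)
Lemma ultralimit_in_Wstar (U : set_system nat) (UU : UltraFilter U)
    (xinf : fam) (yinf : 'cV[R]_l) :
  \oo `<=` U -> (forall i, x k i @[k --> U] --> xinf i) ->
  y k @[k --> U] --> yinf -> in_Wstar theta X A b xinf yinf.
Proof.
move=> ooU xU yU.
have dU i : d k i @[k --> U] --> (0 : 'cV[R]_(n i)).
  exact: cvg_trans (cvg_app _ ooU) (@steps_cvg0 i).
have rU : r k @[k --> U] --> (0 : 'cV[R]_l).
  exact: cvg_trans (cvg_app _ ooU) residual_cvg0.
have xSU i : x k.+1 i @[k --> U] --> xinf i.
  rewrite (_ : (fun k => x k.+1 i) = (fun k => x k i - d k i)).
    by rewrite -[xinf i]subr0; exact: (cvgB (xU i) (dU i)).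
  by apply/funext => k; rewrite /d subKr.
have fU : Asum_front A (x k.+1) @[k --> U] --> Asum_front A xinf.
  by apply: cvg_sumr => i _; exact: cvg_mulmxr.
(* The residual mixes new and old blocks, but both have the limit [xinf], so its limit is
   [Asum A xinf - b]. *)
have feas : Asum A xinf = b.
  apply/eqP; rewrite (AsumE hm) -subr_eq0; apply/eqP.
  apply: (cvg_unique (@norm_hausdorff _ _) _ rU).
  apply: cvgB; last exact: cvg_cst.
  by apply: cvgD => //; exact: cvg_mulmxr.
have ySU : y k.+1 @[k --> U] --> yinf.
  (* The dual update rewritten through the residual and the step, both of which tend to 0. *)
  rewrite (_ : (fun k => y k.+1) =
      (fun k => y k - rho *: (gamma *: r k - A mm *m d k mm))).
    have -> : yinf = yinf - rho *: (gamma *: 0 - A mm *m 0).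
      by rewrite mulmx0 scaler0 subr0 scaler0 subr0.
    apply: (cvgB yU); apply: cvgZr; apply: cvgB; first exact: cvgZr.
    exact: (cvg_mulmxr (dU mm)).
  apply/funext => k; have [_ _ ->] := xstep k.
  rewrite /r /residual /d mulmxBr.
  by apply/colP => i; rewrite !mxE; ring.
split=> [i|u z Xu].
  apply: (@closed_cvg _ _ U _ (fun k => x k i) (X i) (@X_closed i) _ _ (xU i)).
  by apply: nearW => k; exact: xX.
rewrite VI_termE feas subrr dotv0r addr0.
have hU i : u i - x k.+1 i @[k --> U] --> u i - xinf i.
  exact: (cvgB (cvg_cst _) (xSU i)).
suff lim : theta_sum theta u - theta_sum theta (x k.+1)
       - dotv (Asum_front A (fun i => u i - x k.+1 i)) (y k - rho *: r k)
       - dotv (A mm *m (u mm - x k.+1 mm)) (y k.+1)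
       - B (fun i => u i - x k.+1 i) (d k) @[k --> U] -->
    theta_sum theta u - theta_sum theta xinf
       - dotv (Asum_front A (fun i => u i - xinf i)) (yinf - rho *: 0)
       - dotv (A mm *m (u mm - xinf mm)) yinf
       - B (fun i => u i - xinf i) (fun=> 0).
  have : 0 <= theta_sum theta u - theta_sum theta xinf
       - dotv (Asum_front A (fun i => u i - xinf i)) (yinf - rho *: 0)
       - dotv (A mm *m (u mm - xinf mm)) yinf
       - B (fun i => u i - xinf i) (fun=> 0).
    apply: (cvgr_to_ge lim); apply: nearW => k.
    exact: (step_VI theta_conv X_conv rho0 Pspd (xstep k) Xu).
  rewrite scaler0 subr0 (AsumE hm) dotvDl.
  rewrite (_ : B _ _ = 0); first by rewrite subr0 opprD !addrA.
  rewrite -(mul0r (B (fun i => u i - xinf i) (fun=> 0))) -blockformZr.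
  by congr (B _ _); apply: functional_extensionality_dep => i; rewrite scaler0.
apply: cvgB; last exact: cvg_blockform.
apply: cvgB; last exact: (cvg_dotv (cvg_mulmxr (hU mm)) ySU).
apply: cvgB; last first.
  apply: cvg_dotv; last by apply: (cvgB yU); apply: cvgZr.
  by apply: cvg_sumr => i _; exact: (cvg_mulmxr (hU i)).
apply: cvgB; first exact: cvg_cst.
apply: cvg_sumr => i _.
exact: (cvg_comp _ _ (xSU i) (@convex_function_continuous _ _ _ (@theta_conv i) (xinf i))).
Qed.

End GivenSolution.

(** The given solution only provides boundedness and vanishing steps. Once the ultrafilter limit is
    known to be a solution, [V] is recentred there, and [lyap_bound] turns its decay into
    convergence of every block. *)
Lemma lgadmm_cvg : (exists us ys, in_Wstar theta X A b us ys) ->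
  exists xinf yinf, [/\ forall i, x^~ i @ \oo --> xinf i, y @ \oo --> yinf &
    in_Wstar theta X A b xinf yinf].
Proof.
move=> [us [ys W]].
have [U [UU ooU]] := @ultraFilterLemma nat \oo _.
have [xU [yinf yU]] := iterates_ultra_cvg W UU.
pose xinf i := sval (cid (xU i)).
have xinfU i : x k i @[k --> U] --> xinf i := svalP (cid (xU i)).
have Winf := ultralimit_in_Wstar W UU ooU xinfU yU.
have VU : V xinf yinf k @[k --> U] --> (0 : R).
  have xd i : x k i - xinf i @[k --> U] --> (0 : 'cV[R]_(n i)).
    by rewrite -(subrr (xinf i)); exact: (cvgB (xinfU i) (cvg_cst _)).
  have yd : y k - yinf @[k --> U] --> (0 : 'cV[R]_l).
    by rewrite -(subrr yinf); exact: (cvgB yU (cvg_cst _)).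
  have Axd : A mm *m (x k mm - xinf mm) @[k --> U] --> (0 : 'cV[R]_l).
    by rewrite -(mulmx0 _ (A mm)); exact: (cvg_mulmxr (xd mm)).
  (* The limit 0 is written as the value of the two forms at zero error, to match the limit term by
     term. *)
  rewrite [X in _ --> X](_ : 0 = B (fun=> 0) (fun=> 0) + dualform rho gamma 0 (0 : 'cV[R]_l)).
    apply: cvgD; first
      exact: (@cvg_blockform _ _ _ _ rho A P _ U _ (fun k i => x k i - xinf i)
        (fun k i => x k i - xinf i) (fun=> 0) (fun=> 0) xd xd).
    apply: cvgD; last by apply: cvgMr; exact: (cvg_dotv yd yd).
    by apply: cvgD; apply: cvgMr; [exact: (cvg_dotv Axd Axd)|exact: (cvg_dotv Axd yd)].
  rewrite /dualform /sqnorm !dotv0l !mulr0 !addr0.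
  rewrite -[LHS](mul0r (B (fun=> 0) (fun=> 0))) -blockformZr.
  by congr (B _ _); apply: functional_extensionality_dep => i; rewrite scaler0.
have Voo : V xinf yinf @ \oo --> (0 : R).
  apply: nonincreasing_cvg0_finer VU => k; first exact: lyap_noninc.
  exact: lyap_ge0.
have [K HK] := lyap_bound.
have KV : K * V xinf yinf k @[k --> \oo] --> (0 : R).
  by rewrite -(mulr0 K); apply: cvgMr.
exists xinf, yinf; split=> // [i|]; apply: sqnorm_cvg;
  (apply: (@squeeze_cvgr _ _ _ _ (fun=> 0) (fun k => K * V xinf yinf k)) => //;
   last exact: cvg_cst).
  by apply: nearW => k; rewrite sqnorm_ge0; have [->] := HK xinf yinf k.
by apply: nearW => k; rewrite sqnorm_ge0; have [_ ->] := HK xinf yinf k.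
Qed.

End Convergence.

(** * Application to the L-GADMM iteration *)

Unset Implicit Arguments.

Theorem theorem3p1 (R : realType) (m l : nat) (hm : (2 <= m)%N)
  (n : 'I_m -> nat) (hl : (0 < l)%N) (hn : forall i, (0 < n i)%N)
  (theta : forall i, 'cV[R]_(n i) -> R)
  (X : forall i, set 'cV[R]_(n i))
  (A : forall i, 'M[R]_(l, n i)) (b : 'cV[R]_l)
  (rho gamma : R) (P : forall i, 'M[R]_(n i)) :
  (forall i, convex_function setT (theta i)) ->
  (forall i, X i !=set0 /\ closed (X i) /\ @convex_set R 'cV[R]_(n i) (X i)) ->
  (forall i, \rank (A i) = n i) ->
  (exists u, optimal theta X A b u) ->
  (exists us ys, in_Wstar theta X A b us ys) ->
  0 < rho -> 0 < gamma < 2 ->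
  (forall i, spd (P i)) ->
  G1_posdef rho A P ->
  let mm := last_ix (ltnW hm) in
  forall (x : nat -> forall i, 'cV[R]_(n i)) (y : nat -> 'cV[R]_l),
  (forall i, X i (x 0%N i)) ->
  (forall k (j : 'I_m), front j ->
     is_argmin (X j)
       (fun z => theta j z
          + rho / 2 * sqnorm (A j *m z
                              + \sum_(i < m | i != j) A i *m x k i
                              - b - rho^-1 *: y k)
          + 2^-1 * Gnorm2 (P j) (z - x k j))
       (x k.+1 j)) ->
  (forall k,
     is_argmin (X mm)
       (fun z => theta mm z
          + rho / 2 * sqnorm (gamma *: Asum_front A (x k.+1)
                              + (1 - gamma) *: (b - A mm *m x k mm)
                              + A mm *m z - b - rho^-1 *: y k)
          + 2^-1 * Gnorm2 (P mm) (z - x k mm))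
       (x k.+1 mm)) ->
  (forall k,
     y k.+1 = y k - rho *: (gamma *: Asum_front A (x k.+1)
                            + (1 - gamma) *: (b - A mm *m x k mm)
                            + A mm *m x k.+1 mm - b)) ->
  exists (xinf : forall i, 'cV[R]_(n i)) (yinf : 'cV[R]_l),
    (forall i, x^~ i @ \oo --> xinf i) /\
    y @ \oo --> yinf /\
    in_Wstar theta X A b xinf yinf /\
    optimal theta X A b xinf.
Proof.
move=> theta_conv HX _ _ Wne rho0 gamma02 Pspd G1pd mm x y x0X xj xm yE.
have X_conv i : @convex_set R 'cV[R]_(n i) (X i) by have [_ []] := HX i.
have X_closed i : closed (X i) by have [_ []] := HX i.
(* Membership is assumed for the starting point; every later block is a minimiser over [X i]. *)
have xX k i : X i (x k i).
  case: k => [|k]; first exact: x0X.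
  have [fi|] := boolP (front i); first by have [] := xj k i fi.
  by rewrite (front_last (ltnW hm)) negbK => /eqP ->; have [] := xm k.
have xstep k : lgadmm_step (ltnW hm) theta X A b rho gamma P
  (x k) (y k) (x k.+1) (y k.+1) by split => [j|//|//]; exact: xj.
have [xinf [yinf [xcv ycv Winf]]] := lgadmm_cvg theta_conv X_conv X_closed rho0
  gamma02 Pspd G1pd xX xstep Wne.
exists xinf, yinf; do 3 split=> //.
exact: (Wstar_optimal Winf).
Qed.
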